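(* For every positive integer $n$, let $$U(n)=2\left\lfloor\frac{2^n}{2(n+1)}\right\rfloor,\qquad r(n)=2^n-(n+1)U(n),\qquad M_{\rm ad}(n)=\begin{cases}U(n)&\text{if } r(n)<2n,\\ U(n)+1 & \text{if } r(n)\ge 2n.\end{cases}$$ Then in the binary symmetric channel with two feedbacks and a single error, $M_{\rm ad}(n)$ messages can be transmitted with a strategy of length $n$.
   Context: Binary symmetric channel: alphabet $\{0,1\}$, an error replaces a symbol by the other symbol; ''a single error'' means at most one error during the whole transmission. A strategy of length $n$ with $k$ feedbacks: $n=n_1+\cdots+n_{k+1}$; for a message $m\in[M]$, the first $n_1$ symbols depend only on $m$; after $N_{i-1}=n_1+\cdots+n_{i-1}$ symbols have been sent ($i\ge2$), the encoder knows (error-free, instantaneously) the $N_{i-1}$ received symbols, and the $i$th block of $n_i$ symbols is a function of $m$ and these received symbols. The strategy transmits $M$ messages with a single error if the sets of output sequences reachable from distinct messages with at most one error are pairwise disjoint. *)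

(* Defs.v *)
From mathcomp Require Import all_boot.
Set Implicit Arguments. Unset Strict Implicit. Unset Printing Implicit Defensive.

Definition psum (blocks : seq nat) (j : nat) : nat := sumn (take j blocks).

(* Number N_{i-1} of symbols sent before the block containing position t
   (positions are 0-based): the largest partial sum P_j (j <= k) with P_j <= t. *)
Definition block_start (blocks : seq nat) (t : nat) : nat :=
  \max_(j < size blocks | psum blocks j <= t) psum blocks j.

(* An encoder: given the message, the received symbols known so far, and
   the position t, it outputs the symbol sent at position t.  It is only ever
   fed the first [block_start blocks t] received symbols. *)
Definition encoder (M : nat) := 'I_M -> seq bool -> nat -> bool.

Definition received (n : nat) (blocks : seq nat) (M : nat) (enc : encoder M)
    (m : 'I_M) (err : option 'I_n) : seq bool :=
  foldl (fun ys t =>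
           rcons ys (enc m (take (block_start blocks t) ys) t
                     (+) (omap val err == Some t)))
        [::] (iota 0 n).

Record strategy (n k M : nat) := Strategy {
  st_blocks : seq nat;
  st_enc : encoder M;
  st_size : size st_blocks = k.+1;
  st_sum : sumn st_blocks = n
}.

Definition transmits_single_error n k M (S : strategy n k M) : Prop :=
  forall (m1 m2 : 'I_M) (e1 e2 : option 'I_n), m1 <> m2 ->
    received (st_blocks S) (st_enc S) m1 e1 <> received (st_blocks S) (st_enc S) m2 e2.

Definition U (n : nat) : nat := 2 * (2 ^ n %/ (2 * n.+1)).
Definition r (n : nat) : nat := 2 ^ n - n.+1 * U n.
Definition Mad (n : nat) : nat := if r n < 2 * n then U n else (U n).+1.

(* Main.v *)
Require Import Defs.
From mathcomp Require Import all_boot.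
From mathcomp Require Import all_algebra.
From mathcomp Require Import zify.

(** Put [N = n - 1] and let [t] be maximal with [2 ^ t <= N + 1].  The blocks have lengths
    [1], [d] and [2 ^ t - 1], where [1 + d + (2 ^ t - 1) = n].  The first symbol splits
    the messages into halves; after it is received, [a] messages are consistent with no
    error and [b] with one, where [a * (N + 1) + b <= 2 ^ N] and [a <= b + 1].  In the
    second block the [a] messages are spread as evenly as possible over the words of
    length [d]; the [b] others, which tolerate no further error, then fill the remaining
    room, so that for every received word the [a'] messages with no error and the [b']
    messages with one error satisfy [a' * 2 ^ t + b' <= 2 ^ (2 ^ t - 1)].  In the last
    block the [a'] messages use words of a perfect Hamming code of length [2 ^ t - 1],
    and the [b'] messages use words outside the radius-one balls around them. *)

Set Implicit Arguments. Unset Strict Implicit. Unset Printing Implicit Defensive.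

(** * Finite sets and assignments with prescribed capacities *)

Lemma exists_set_card (T : finType) (k : nat) :
  k <= #|T| -> exists D : {set T}, #|D| = k.
Proof.
move=> lek; exists [set x in take k (enum T)].
rewrite cardsE (card_uniqP _); last exact: take_uniq (enum_uniq T).
by rewrite size_takel // -cardE.
Qed.

Lemma leq_card_bigcup (I T : finType) (P : pred I) (F : I -> {set T}) :
  #|\bigcup_(i | P i) F i| <= \sum_(i | P i) #|F i|.
Proof.
elim/big_rec2: _ => [|i s S _ leS]; first by rewrite cards0.
by apply: leq_trans (leq_card_setU _ _).1 _; rewrite leq_add2l.
Qed.

Lemma card_fibers (T Y : finType) (B : {set T}) (g : T -> Y) :
  \sum_y #|[set m in B | g m == y]| = #|B|.
Proof.
rewrite -sum1_card (partition_big g predT) //=.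
by apply: eq_bigr => y _; rewrite -sum1_card; apply: eq_bigl => m; rewrite inE.
Qed.

(** Greedy assignment: set one element [m] aside and assign the rest. Their number is below the
    total capacity, so some [y] has room left for [m]. *)
Lemma exists_bounded_fibers (T Y : finType) (y0 : Y) (B : {set T}) (cap : Y -> nat) :
  #|B| <= \sum_y cap y ->
  exists g : T -> Y, forall y, #|[set m in B | g m == y]| <= cap y.
Proof.
have [k] := ubnP #|B|; elim: k B => // k IH B ltBk leB.
have [->|[m mB]] := set_0Vmem B.
  exists (fun=> y0) => y; rewrite (_ : [set _ in _ | _] = set0) ?cards0 //.
  by apply/setP=> x; rewrite !inE.
have cB : #|B| = #|B :\ m|.+1 by rewrite (cardsD1 m) mB.
have [||g gP] := IH (B :\ m); [by rewrite cB in ltBk | by rewrite ltnW // -cB |].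
have [y lty] : exists y, #|[set x in B :\ m | g x == y]| < cap y.
  apply/existsP; apply: contraLR leB => /existsPn nlt.
  rewrite -ltnNge cB ltnS -(card_fibers (B :\ m) g).
  by apply: leq_sum => y _; rewrite leqNgt nlt.
exists (fun x => if x == m then y else g x) => z.
have [-> | neq] := eqVneq z y.
  apply: leq_trans lty; rewrite -(add1n #|_|) -(cards1 m).
  apply: leq_trans (leq_card_setU _ _).1; apply: subset_leq_card.
  by apply/subsetP=> x; rewrite !inE; case: (x == m).
apply: leq_trans (gP z); apply: subset_leq_card.
apply/subsetP=> x; rewrite !inE; case: (x == m) => //=.
by rewrite eq_sym (negPf neq) andbF.
Qed.

(** The indicator function of [H] serves as capacity: 1 on [H] gives injectivity, 0 elsewhere keeps
    the values in [H]. *)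
Lemma exists_injection (T Y : finType) (y0 : Y) (B : {set T}) (H : {set Y}) :
  #|B| <= #|H| ->
  exists2 g : T -> Y, {in B, forall m, g m \in H} & {in B &, injective g}.
Proof.
move=> leBH; have [|g gP] := @exists_bounded_fibers T Y y0 B (fun y => y \in H).
  by apply: leq_trans leBH _; rewrite -sum1_card big_mkcond leq_sum // => y _; case: ifP.
exists g => [m mB | m m' mB m'B eqg].
  apply: contraT => /negPf gH; have := gP (g m); rewrite gH leqn0 cards_eq0.
  by move/eqP/setP/(_ m); rewrite !inE mB eqxx.
have /card_le1_eqP le1 : #|[set x in B | g x == g m]| <= 1.
  by apply: leq_trans (gP _) _; case: (_ \in _).
by apply: le1; rewrite inE ?mB ?m'B ?eqg eqxx.
Qed.

(** * Binary words and Hamming distance *)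

Definition word (k : nat) := {ffun 'I_k -> bool}.

Definition dist k (x y : word k) : nat := \sum_(j < k) (x j (+) y j).

Definition flip k (x : word k) (i : 'I_k) : word k := [ffun j => x j (+) (j == i)].

Lemma card_word k : #|{: word k}| = 2 ^ k.
Proof. by rewrite card_ffun card_bool card_ord. Qed.

Lemma flipK k (i : 'I_k) : involutive (fun x : word k => flip x i).
Proof. by move=> x; apply/ffunP=> j; rewrite !ffunE addbK. Qed.

Lemma dist_eq0 k (x y : word k) : (dist x y == 0) = (x == y).
Proof.
rewrite sum_nat_eq0; apply/forallP/eqP => [xy | -> i]; last by rewrite addbb.
by apply/ffunP=> j; have := xy j; case: (x j); case: (y j).
Qed.

Lemma dist_le1 k (x y : word k) :
  dist x y <= 1 -> x = y \/ exists i, x = flip y i.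
Proof.
move=> le1; have [/eqP|] := eqVneq (dist x y) 0.
  by rewrite dist_eq0 => /eqP; left.
rewrite sum_nat_eq0 negb_forall => /existsP[i]; rewrite /= eqb0 negbK => xyi.
right; exists i; apply/ffunP=> j; rewrite ffunE.
have [-> | ji] := eqVneq j i; first by move: xyi; case: (x i); case: (y i).
move: le1; rewrite /dist (bigD1 i) //= (bigD1 j) //= xyi.
by case: (x j); case: (y j).
Qed.

Lemma dist_eq1 k (x y : word k) : dist x y = 1 -> exists i, x = flip y i.
Proof.
move=> d1; have [eqxy|//] : x = y \/ exists i, x = flip y i by apply: dist_le1; rewrite d1.
by move/eqP: eqxy; rewrite -dist_eq0 d1.
Qed.

(** * Hamming codes *)

Section Hamming.
Variable t : nat.
Import GRing.Theory.
Local Open Scope ring_scope.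
Let V := 'rV['F_2]_t.

(** These are the columns of the parity-check matrix: an enumeration of all nonzero vectors of the
    space. *)
Lemma exists_parity_columns :
  exists2 h : 'I_(2 ^ t - 1) -> V, injective h & forall j, h j != 0.
Proof.
have cV : #|[set v : V | v != 0]| = (2 ^ t - 1)%N.
  rewrite (_ : [set v | _] = [set~ 0]); last by apply/setP=> v; rewrite !inE.
  by rewrite cardsC1 card_mx card_Fp // mul1n subn1.
exists (fun j => enum_val (cast_ord (esym cV) j)).
  by move=> i j /enum_val_inj /cast_ord_inj.
by move=> j; have := enum_valP (cast_ord (esym cV) j); rewrite inE.
Qed.

Definition syndrome k (h : 'I_k -> V) (x : word k) : V := \sum_(j | x j) h j.

Lemma addVV (v : V) : v + v = 0.
Proof. by rewrite -mulr2n -scaler_nat (_ : 2%:R = 0) ?scale0r //; apply/val_inj. Qed.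

Lemma syndrome_flip k (h : 'I_k -> V) x i :
  syndrome h (flip x i) = syndrome h x + h i.
Proof.
rewrite /syndrome big_mkcond (bigD1 i) //= [in RHS]big_mkcond [in RHS](bigD1 i) //=.
rewrite ffunE eqxx addbT.
rewrite (eq_bigr (fun j => if x j then h j else 0)) => [|j /negPf ji]; last first.
  by rewrite ffunE ji addbF.
case: (x i); last by rewrite add0r addrC.
by rewrite add0r [RHS]addrC addrA addVV add0r.
Qed.

(** Both words differ from [y] in at most one place. Comparing their syndromes with that of [y]
    gives [h i = 0], which is excluded, or [h i = h j], hence [i = j]. *)
Lemma syndrome_inj_ball (h : 'I_(2 ^ t - 1) -> V) (x x' y : word (2 ^ t - 1)) :
  injective h -> (forall j, h j != 0) ->
  (dist x y <= 1)%N -> (dist x' y <= 1)%N -> syndrome h x = syndrome h x' -> x = x'.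
Proof.
move=> hI h0 /dist_le1[-> | [i ->]] /dist_le1[-> | [j ->]] //; rewrite !syndrome_flip.
- by move/eqP; rewrite addrC -subr_eq subrr eq_sym (negPf (h0 _)).
- by move/esym/eqP; rewrite addrC -subr_eq subrr eq_sym (negPf (h0 _)).
- by move/addrI/hI->.
Qed.

End Hamming.

(** Pigeonhole over the [2 ^ t] syndromes gives a class of at least average size. Any such class
    will do, so the dimension of the kernel need not be computed. *)
Lemma exists_hamming_code t :
  exists2 H : {set word (2 ^ t - 1)}, 2 ^ (2 ^ t - 1) <= #|H| * 2 ^ t &
    forall x x' y, x \in H -> x' \in H -> dist x y <= 1 -> dist x' y <= 1 -> x = x'.
Proof.
have [h hI h0] := exists_parity_columns t.
have [z leK] : exists z, 2 ^ (2 ^ t - 1) <= #|[set x | syndrome h x == z]| * 2 ^ t.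
  apply/existsP; apply: contraT => /existsPn small.
  have cV : #|{: 'rV['F_2]_t}| = 2 ^ t by rewrite card_mx card_Fp // mul1n.
  have leS : 2 ^ (2 ^ t - 1) * 2 ^ t <= #|{: 'rV['F_2]_t}| * (2 ^ (2 ^ t - 1)).-1.
    rewrite -{1}card_word -cardsT -(card_fibers setT (syndrome h)) big_distrl /=.
    rewrite -sum_nat_const; apply: leq_sum => z _.
    rewrite (_ : [set _ in _ | _] = [set x | syndrome h x == z]).
      by rewrite -ltnS prednK ?expn_gt0 // ltnNge small.
    by apply/setP=> x; rewrite !inE.
  have : 0 < 2 ^ t by rewrite expn_gt0.
  have : 0 < 2 ^ (2 ^ t - 1) by rewrite expn_gt0.
  by move: leS; rewrite cV; move: (2 ^ (2 ^ t - 1)) (2 ^ t) => K L; nia.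
exists [set x | syndrome h x == z] => // x x' y; rewrite !inE => /eqP sx /eqP sx' dx dx'.
by apply: (syndrome_inj_ball hI h0 dx dx'); rewrite sx.
Qed.

Lemma card_ball_le k (x : word k) : #|[set y | dist x y <= 1]| <= k.+1.
Proof.
suff sub : [set y | dist x y <= 1] \subset x |: [set flip x i | i : 'I_k].
  apply: leq_trans (subset_leq_card sub) _; apply: leq_trans (leq_card_setU _ _).1 _.
  by rewrite cards1 add1n ltnS (leq_trans (leq_imset_card _ _)) // card_ord.
apply/subsetP=> y; rewrite !inE => /dist_le1[-> | [i ->]]; first by rewrite eqxx.
by apply/orP; right; apply/imsetP; exists i => //; rewrite (flipK i).
Qed.

(** * The three blocks *)

(* [w m] is the number of errors that message [m] has incurred so far. *)
Lemma last_block (T : finType) (t : nat) (w : T -> nat) :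
  #|[set m | w m == 0]| * 2 ^ t + #|[set m | w m == 1]| <= 2 ^ (2 ^ t - 1) ->
  exists c : T -> word (2 ^ t - 1), forall y m m',
    w m + dist (c m) y <= 1 -> w m' + dist (c m') y <= 1 -> m = m'.
Proof.
set A := [set m | w m == 0]; set B := [set m | w m == 1] => vol.
have [H leH Hdec] := exists_hamming_code t.
have t0 : 0 < 2 ^ t by rewrite expn_gt0.
pose x0 : word (2 ^ t - 1) := [ffun=> false].
have [|cA cAH cAI] := @exists_injection _ _ x0 A H.
  by rewrite -(leq_pmul2r t0) (leq_trans _ leH) // (leq_trans _ vol) ?leq_addr.
pose F := \bigcup_(m in A) [set y | dist (cA m) y <= 1].
have leF : #|F| <= #|A| * 2 ^ t.
  rewrite -sum_nat_const; apply: leq_trans (leq_card_bigcup _ _) _.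
  apply: leq_sum => m _; apply: leq_trans (card_ball_le _) _; lia.
(* A ball has at most [2 ^ t] words, so [vol] leaves at least [#|B|] words outside [F]. *)
have [|cB cBF cBI] := @exists_injection _ _ x0 B (~: F).
  by have := cardsC F; rewrite card_word; lia.
exists (fun m => if w m == 0 then cA m else cB m) => y m m'.
(* A message with one error already tolerates only its own word, and that word lies outside every
   ball around a codeword in use. *)
have key u v : w u = 0 -> w v + dist (cB v) y <= 1 -> dist (cA u) y <= 1 -> w v == 0.
  move=> wu wv du; apply: contraT => wv0.
  have d0 : dist (cB v) y = 0 by lia.
  have vB : v \in B by rewrite inE; lia.
  have := cBF v vB; rewrite inE => /bigcupP[]; exists u; first by rewrite inE wu.
  by move/eqP: d0; rewrite dist_eq0 inE => /eqP->.
case: (eqVneq (w m) 0) => [wm | wm]; case: (eqVneq (w m') 0) => [wm' | wm'] => h h'.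
- apply: cAI; rewrite ?inE ?wm ?wm' //.
  by apply: (Hdec _ _ y); rewrite ?cAH ?inE ?wm ?wm' //; lia.
- by case/negP: wm'; apply: (key m m') => //; lia.
- by case/negP: wm; apply: (key m' m) => //; lia.
- apply: cBI; rewrite ?inE; [lia|lia|].
  have /eqP : dist (cB m) y = 0 by lia.
  have /eqP : dist (cB m') y = 0 by lia.
  by rewrite !dist_eq0 => /eqP-> /eqP->.
Qed.

Lemma middle_block (T : finType) (d L K : nat) (w : T -> nat) (f : word d -> nat) :
  #|[set m | w m == 0]| * (L + d) + #|[set m | w m == 1]| <= K * 2 ^ d ->
  #|[set m | w m == 0]| <= \sum_y f y ->
  (forall y, f y * L + \sum_(i < d) f (flip y i) <= K) ->
  exists c : T -> word d, forall y,
    #|[set m | w m + dist (c m) y == 0]| * L + #|[set m | w m + dist (c m) y == 1]| <= K.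
Proof.
set A := [set m | w m == 0]; set B := [set m | w m == 1] => vol leA fK.
pose x0 : word d := [ffun=> false].
have [cA cAf] := exists_bounded_fibers x0 leA.
pose g y := #|[set m in A | cA m == y]|.
(* The share of the budget [K] at received word [y] that [A] consumes: no-error messages weigh [L],
   and those sent as a neighbour of [y] now have one error and weigh 1. *)
pose load y := g y * L + \sum_(i < d) g (flip y i).
have loadK y : load y <= K.
  apply: leq_trans (fK y); apply: leq_add; first by rewrite leq_mul2r cAf orbT.
  by apply: leq_sum => i _; apply: cAf.
(* Double counting: each message of [A] contributes [L] at its own word and 1 at each of the [d]
   neighbours. *)
have sum_load : \sum_y load y = #|A| * (L + d).
  rewrite big_split /= -big_distrl /= card_fibers exchange_big /= mulnDr; congr (_ + _).
  rewrite (eq_bigr (fun=> #|A|)); first by rewrite sum_nat_const card_ord mulnC.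
  by move=> i _; rewrite -(card_fibers A cA) [RHS](reindex_inj (inv_inj (flipK i))).
(* A message of [B] survives only at its own word, so it weighs 1 there and the remaining room
   [K - load y] is its capacity. *)
have [|cB cBcap] := @exists_bounded_fibers _ _ x0 B (fun y => K - load y).
  rewrite -(leq_add2l (\sum_y load y)) -big_split /= sum_load.
  rewrite (eq_bigr (fun=> K)) => [|y _]; last by rewrite subnKC.
  by rewrite sum_nat_const card_word mulnC [2 ^ d * K]mulnC; lia.
exists (fun m => if w m == 0 then cA m else cB m) => y.
rewrite (_ : [set m | _ == 0] = [set m in A | cA m == y]); last first.
  apply/setP=> m; rewrite !inE addn_eq0 dist_eq0.
  by case: (w m == 0).
set S := [set m | _ == 1].
have sub : S \subset (\bigcup_(i < d) [set m in A | cA m == flip y i])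
                     :|: [set m in B | cB m == y].
  apply/subsetP=> m; rewrite !inE; case: (eqVneq (w m) 0) => wm.
    rewrite wm add0n => /eqP/dist_eq1[i cAm]; apply/orP; left.
    by apply/bigcupP; exists i; rewrite // !inE wm cAm !eqxx.
  move=> h; have w1 : w m = 1 by lia.
  have : dist (cB m) y == 0 by lia.
  by rewrite w1 dist_eq0 /= => ->; rewrite orbT.
have leS : #|S| <= \sum_(i < d) g (flip y i) + (K - load y).
  apply: leq_trans (subset_leq_card sub) _; apply: leq_trans (leq_card_setU _ _).1 _.
  by apply: leq_add (cBcap y); apply: leq_card_bigcup.
apply: leq_trans (leq_add (leqnn _) leS) _.
by rewrite addnA (subnKC (loadK y)).
Qed.

(** * Even spreading over the words of the middle block *)

Lemma card_flip_in_le d (G : {set word d}) (y : word d) :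
  \sum_(i < d) (flip y i \in G) <= minn d #|G :\ y|.
Proof.
rewrite leq_min; apply/andP; split.
  rewrite -[X in _ <= X]card_ord -sum1_card; apply: leq_sum => i _.
  by case: (_ \in _).
have flipI : injective (flip y).
  move=> i j /ffunP/(_ i); rewrite !ffunE eqxx => /addbI/esym.
  by move/eqP.
rewrite -big_mkcond sum1_card -(card_imset _ flipI); apply: subset_leq_card.
apply/subsetP=> x /imsetP[i iG ->]; rewrite !inE.
have -> : flip y i \in G by []; rewrite andbT.
by apply/eqP => /ffunP/(_ i); rewrite ffunE eqxx; case: (y i).
Qed.

(* Here [f] takes the values [q] and [q + 1], where [q = a %/ 2 ^ d]. *)
Lemma exists_balanced_load (d L K a : nat) :
  0 < L -> a * (L + d) <= K * 2 ^ d ->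
  a %% 2 ^ d = 0 \/ a %/ 2 ^ d * (L + d) + L + minn d (a %% 2 ^ d).-1 <= K ->
  exists2 f : word d -> nat, a <= \sum_y f y &
    forall y, f y * L + \sum_(i < d) f (flip y i) <= K.
Proof.
move=> L0 vol bal; set q := a %/ 2 ^ d in bal *; set s := a %% 2 ^ d in bal *.
have eqa : a = q * 2 ^ d + s by exact: divn_eq.
have lts : s < 2 ^ d by rewrite ltn_pmod ?expn_gt0.
clearbody q s.
have D0 : 0 < 2 ^ d by rewrite expn_gt0.
have [|G cG] := @exists_set_card (word d) s; first by rewrite card_word ltnW.
exists (fun y => q + (y \in G)) => [|y].
  by rewrite big_split /= sum_nat_const card_word -big_mkcond sum1_card cG eqa mulnC.
rewrite big_split /= sum_nat_const card_ord.
have := card_flip_in_le G y; have := cardsD1 y G; rewrite cG.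
move: (\sum_(i < d) _) #|_ :\ _| (y \in G) => S g inG.
case: bal => [s0 | bal].
  have : q * (L + d) <= K by rewrite -(leq_pmul2r D0); move: vol; rewrite eqa s0; lia.
  by rewrite s0; case: inG; lia.
by move: bal; case: inG; lia.
Qed.

(** Here [N <= 14]: once the powers are evaluated, each of the finitely many cases is linear. The
    bound [a <= b.+1] matters: for [N = 4], [t = 2], [a = 3], [b = 1] the volume bound holds but the
    conclusion fails. *)
Lemma balanced_load_small (N t a b : nat) (d := N - (2 ^ t - 1)) :
  t < 4 -> 2 ^ t <= N.+1 < 2 ^ t.+1 ->
  a * N.+1 + b <= 2 ^ (2 ^ t - 1) * 2 ^ d -> a <= b.+1 -> a %% 2 ^ d != 0 ->
  a %/ 2 ^ d * N.+1 + 2 ^ t + minn d (a %% 2 ^ d).-1 <= 2 ^ (2 ^ t - 1).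
Proof.
move=> t4 tN; have D0 : 0 < 2 ^ d by rewrite expn_gt0.
move: (divn_eq a (2 ^ d)) (ltn_pmod a D0).
move: (a %/ 2 ^ d) (a %% 2 ^ d) => q s; subst d; clear D0.
case: t t4 tN => [|[|[|[|t]]]] // _ tN.
all: case: N tN => [|[|[|[|[|[|[|[|[|[|[|[|[|[|[|N]]]]]]]]]]]]]]] // tN.
all: repeat match goal with |- context [2 ^ ?e] =>
       let v := eval vm_compute in (2 ^ e) in change (2 ^ e) with v end.
all: lia.
Qed.

(** Supplies the balance condition of [exists_balanced_load] for [L = 2 ^ t], where
    [L + d = N.+1]. *)
Lemma balanced_load (N t a b : nat) (d := N - (2 ^ t - 1)) :
  2 ^ t <= N.+1 < 2 ^ t.+1 ->
  a * N.+1 + b <= 2 ^ (2 ^ t - 1) * 2 ^ d -> a <= b.+1 ->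
  a %% 2 ^ d = 0 \/
  a %/ 2 ^ d * N.+1 + 2 ^ t + minn d (a %% 2 ^ d).-1 <= 2 ^ (2 ^ t - 1).
Proof.
move=> tN vol leab; have [s0 | s0] := eqVneq (a %% 2 ^ d) 0; [by left | right].
have [t4 | t4] := ltnP t 4; first exact: balanced_load_small vol leab s0.
have ltK : N.+1 * N.+1 <= 2 ^ (2 ^ t - 1).
  (* At [t = 3] this would read [8 <= 7], hence the separate treatment of [t < 4]. *)
  have le2 : t.+1 + t.+1 <= 2 ^ t - 1.
    move: t4 {tN d vol s0}; elim: t => // t IH; rewrite leq_eqVlt => /predU1P[<- // | t4].
    by have := IH t4; rewrite expnS; lia.
  apply: leq_trans (leq_pexp2l _ le2) => //; rewrite expnD.
  by case/andP: tN => _ /ltnW tN; apply: leq_mul.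
have D0 : 0 < 2 ^ d by rewrite expn_gt0.
have eqa := divn_eq a (2 ^ d).
have dL : 2 ^ t + minn d (a %% 2 ^ d).-1 <= N.+1.
  have : 0 < 2 ^ t by rewrite expn_gt0.
  by rewrite /d; lia.
rewrite -addnA; apply: leq_trans (leq_add (leqnn _) dL) _.
set q := a %/ _ in eqa *; set s := a %% _ in eqa s0.
move: vol ltK D0; move: (2 ^ (2 ^ t - 1)) (2 ^ d) eqa => K D eqa vol ltK D0.
(* [vol] gives [q * (N + 2) <= K]; replacing [N + 2] by [N + 1] frees [q] units, which
   absorb the extra [N + 1] when [q > N]. *)
have [qN | qN] := leqP q N; first by apply: leq_trans ltK; rewrite -mulSnr leq_mul.
have : q * N.+2 <= K by rewrite -(leq_pmul2r D0); nia.
nia.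
Qed.

Lemma exists_block_codes (M N t : nat) (d := N - (2 ^ t - 1)) :
  2 ^ t <= N.+1 < 2 ^ t.+1 -> uphalf M * N.+1 + M./2 <= 2 ^ N ->
  exists (c1 : 'I_M -> bool) (c2 : bool -> 'I_M -> word d)
    (c3 : bool -> word d -> 'I_M -> word (2 ^ t - 1)),
  forall y1 y2 y3 m m',
    (c1 m (+) y1) + dist (c2 y1 m) y2 + dist (c3 y1 y2 m) y3 <= 1 ->
    (c1 m' (+) y1) + dist (c2 y1 m') y2 + dist (c3 y1 y2 m') y3 <= 1 -> m = m'.
Proof.
move=> tN vol; have t0 : 0 < 2 ^ t by rewrite expn_gt0.
have eqNd : N.+1 = 2 ^ t + d by rewrite /d; lia.
have eqK : 2 ^ N = 2 ^ (2 ^ t - 1) * 2 ^ d by rewrite -expnD; congr (_ ^ _); lia.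
have [|D cD] := @exists_set_card 'I_M M./2; first by rewrite card_ord; lia.
pose c1 m := m \in D.
have stage2 y1 : exists c : 'I_M -> word d, forall y,
    #|[set m | (c1 m (+) y1) + dist (c m) y == 0]| * 2 ^ t
    + #|[set m | (c1 m (+) y1) + dist (c m) y == 1]| <= 2 ^ (2 ^ t - 1).
  pose a := #|[set m | nat_of_bool (c1 m (+) y1) == 0]|.
  pose b := #|[set m | nat_of_bool (c1 m (+) y1) == 1]|.
  (* If [y1] is true the two halves swap roles; the factor [N.+1] then falls on the smaller one, so
     [vol] still suffices. *)
  have volab : a * N.+1 + b <= 2 ^ N /\ a <= b.+1.
    have cDC : #|~: D| = uphalf M by have := cardsC D; rewrite cD card_ord; lia.
    have ea : a = if y1 then M./2 else uphalf M.
      rewrite -cD -cDC /a {a b}; case: y1; apply: eq_card => m; rewrite !inE /c1;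
      by case: (m \in D).
    have eb : b = if y1 then uphalf M else M./2.
      rewrite -cD -cDC /b {a b ea}; case: y1; apply: eq_card => m; rewrite !inE /c1;
      by case: (m \in D).
    move: vol; rewrite ea eb uphalf_half; move: (odd M) (M./2) (2 ^ N) => o u K.
    by case: y1 {a b ea eb}; case: o => /=; lia.
  case: volab => volab leab; rewrite eqK in volab.
  have [||f fa fK] := @exists_balanced_load d (2 ^ t) (2 ^ (2 ^ t - 1)) a t0.
  - by rewrite -eqNd (leq_trans _ volab) ?leq_addr.
  - by rewrite -eqNd; apply: balanced_load volab leab.
  by apply: middle_block fa fK; rewrite -eqNd.
have [[f fP] [g gP]] := (stage2 false, stage2 true).
pose c2 (y1 : bool) := if y1 then g else f.
have c2P y1 y : #|[set m | (c1 m (+) y1) + dist (c2 y1 m) y == 0]| * 2 ^ t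
    + #|[set m | (c1 m (+) y1) + dist (c2 y1 m) y == 1]| <= 2 ^ (2 ^ t - 1).
  by case: y1; [apply: gP | apply: fP].
(* A boolean predicate on a finite type of functions, so that [xchoose] can select a code for every
   pair [y1], [y2] at once. *)
pose good y1 y2 (c : {ffun 'I_M -> word (2 ^ t - 1)}) := [forall y3, forall m, forall m',
  ((c1 m (+) y1) + dist (c2 y1 m) y2 + dist (c m) y3 <= 1) ==>
  ((c1 m' (+) y1) + dist (c2 y1 m') y2 + dist (c m') y3 <= 1) ==> (m == m')].
have stage3 y1 y2 : exists c, good y1 y2 c.
  have [c cP] := last_block (c2P y1 y2).
  exists (finfun c); apply/forallP=> y3; apply/forallP=> m; apply/forallP=> m'.
  by rewrite !ffunE; apply/implyP=> hm; apply/implyP=> hm'; apply/eqP/(cP y3).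
exists c1, c2, (fun y1 y2 m => xchoose (stage3 y1 y2) m) => y1 y2 y3 m m' hm hm'.
have /forallP/(_ y3)/forallP/(_ m)/forallP/(_ m') := xchooseP (stage3 y1 y2).
by rewrite hm hm' => /eqP.
Qed.

(** * The channel *)

Lemma block_start_le blocks t : block_start blocks t <= t.
Proof. exact/bigmax_leqP. Qed.

Lemma psum_le_block_start blocks t j :
  j < size blocks -> psum blocks j <= t -> psum blocks j <= block_start blocks t.
Proof.
move=> ltj le; exact: (@leq_bigmax_cond _ (fun i : 'I__ => psum blocks i <= t)
  (fun i => psum blocks i) (Ordinal ltj)).
Qed.

(** Later steps only append symbols, so the prefix known to the encoder can be read off the final
    sequence. This turns the recursion into an equation. *)
Lemma nth_received n blocks M (enc : encoder M) m (err : option 'I_n) t :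
  t < n ->
  nth false (received blocks enc m err) t =
  enc m (take (block_start blocks t) (received blocks enc m err)) t
    (+) (omap val err == Some t).
Proof.
move=> ltn; rewrite /received; set step := (X in foldl X).
pose ys k := foldl step [::] (iota 0 k).
have ysS k : ys k.+1 = step (ys k) k by rewrite /ys -addn1 iotaD foldl_cat.
have size_ys k : size (ys k) = k by elim: k => // k IH; rewrite ysS size_rcons IH.
have take_ys k l : k <= l -> take k (ys l) = ys k.
  elim: l => [|l IH]; first by rewrite leqn0 => /eqP->.
  rewrite leq_eqVlt => /predU1P[-> | lekl]; first by rewrite take_oversize ?size_ys.
  by rewrite ysS /step -cats1 takel_cat ?size_ys ?IH.
rewrite -/(ys n) -(nth_take _ (ltnSn t)) take_ys // ysS nth_rcons size_ys ltnn eqxx.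
congr (enc _ _ _ (+) _).
rewrite -(take_ys _ _ (ltnW ltn)) take_takel //; exact: block_start_le.
Qed.

Definition segment (ys : seq bool) (o k : nat) : word k :=
  [ffun j : 'I_k => nth false ys (o + j)].

Definition bit k (x : word k) (i : nat) : bool :=
  if insub i is Some j then x j else false.

Lemma bit_ord k (x : word k) (j : 'I_k) : bit x j = x j.
Proof. by rewrite /bit valK. Qed.

Definition three_block_encoder M d k (c1 : 'I_M -> bool) (c2 : bool -> 'I_M -> word d)
    (c3 : bool -> word d -> 'I_M -> word k) : encoder M :=
  fun m ys t =>
    if t == 0 then c1 m
    else if t < d.+1 then bit (c2 (nth false ys 0) m) (t - 1)
    else bit (c3 (nth false ys 0) (segment ys 1 d) m) (t - d.+1).

(** At every position the received symbol differs from the prescribed one exactly when the channel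
    errs, so the left side counts the channel errors. *)
Lemma three_block_errors M d k (c1 : 'I_M -> bool) (c2 : bool -> 'I_M -> word d)
    (c3 : bool -> word d -> 'I_M -> word k) m (err : option 'I_(1 + d + k))
    (Y := received [:: 1; d; k] (three_block_encoder c1 c2 c3) m err)
    (y1 := nth false Y 0) (y2 := segment Y 1 d) (y3 := segment Y d.+1 k) :
  (c1 m (+) y1) + dist (c2 y1 m) y2 + dist (c3 y1 y2 m) y3 <= 1.
Proof.
pose e t : nat := omap val err == Some t.
have e1 : c1 m (+) y1 = e 0 :> nat.
  by rewrite /y1 nth_received // /three_block_encoder /= addKb.
have start1 t : 0 < t -> 0 < block_start [:: 1; d; k] t.
  by move=> t0; apply: (@psum_le_block_start [:: 1; d; k] t 1).
have e2 : dist (c2 y1 m) y2 = \sum_(j < d) e (1 + j).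
  apply: eq_bigr => j _; rewrite ffunE nth_received; last by have := ltn_ord j; lia.
  rewrite /three_block_encoder /= add1n ltnS ltn_ord nth_take ?start1 //.
  by rewrite subn1 bit_ord addKb.
have e3 : dist (c3 y1 y2 m) y3 = \sum_(j < k) e (1 + d + j).
  apply: eq_bigr => j _; rewrite ffunE nth_received; last by have := ltn_ord j; lia.
  rewrite /three_block_encoder addSn /= ltnS ltnNge leq_addr /= nth_take ?start1 //.
  rewrite (_ : segment (take _ _) 1 d = y2); last first.
    apply/ffunP=> i; rewrite !ffunE nth_take //.
    (* The partial sum of index 2 is [d.+1]: throughout the third block the first [d.+1] symbols are
       known, which includes all of the second block. *)
    have := @psum_le_block_start [:: 1; d; k] (d + j).+1 2 isT.
    by rewrite /psum /=; have := ltn_ord i; lia.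
  by rewrite subSS addKn bit_ord addKb.
have -> : (c1 m (+) y1) + dist (c2 y1 m) y2 + dist (c3 y1 y2 m) y3
          = \sum_(t < 1 + d + k) e t.
  by rewrite !big_split_ord /= big_ord1 e1 e2 e3.
rewrite /e; case: (err) => [u|]; last by rewrite big1.
rewrite (bigD1 u) //= eqxx big1 // => t.
rewrite -val_eqE eq_sym /= => /negPf tu; apply/eqP; rewrite eqb0.
by apply/eqP=> -[/eqP]; rewrite tu.
Qed.

Lemma three_block_strategy n M d k (c1 : 'I_M -> bool) (c2 : bool -> 'I_M -> word d)
    (c3 : bool -> word d -> 'I_M -> word k) :
  1 + d + k = n ->
  (forall y1 y2 y3 m m',
    (c1 m (+) y1) + dist (c2 y1 m) y2 + dist (c3 y1 y2 m) y3 <= 1 ->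
    (c1 m' (+) y1) + dist (c2 y1 m') y2 + dist (c3 y1 y2 m') y3 <= 1 -> m = m') ->
  exists S : strategy n 2 M, transmits_single_error S.
Proof.
move=> <- dec.
have sumE : sumn [:: 1; d; k] = 1 + d + k by rewrite /= addn0 addnA.
exists (@Strategy _ 2 _ [:: 1; d; k] (three_block_encoder c1 c2 c3) erefl sumE) => m m' e e' neq eqY.
apply: neq; have h := three_block_errors c1 c2 c3 m e; rewrite eqY in h.
exact: dec h (three_block_errors c1 c2 c3 m' e').
Qed.

(** Let [U n = 2 * u]. For [Mad n = U n] the bound is [u * n.+1 <= 2 ^ n.-1], true by the choice of
    [u] as a floor. For one message more it is [u * n.+1 + n <= 2 ^ n.-1], which doubled says
    [2 * n <= r n]. *)
Lemma Mad_volume n : 0 < n -> uphalf (Mad n) * n + (Mad n)./2 <= 2 ^ n.-1.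
Proof.
case: n => // n _; rewrite /Mad /r /U.
have := leq_divM (2 ^ n.+1) (2 * n.+2).
rewrite expnS; move: (_ %/ _) => u; move: (2 ^ n) => K /= leu.
by case: ltnP => h; nia.
Qed.

Theorem theorem4 (n : nat) : 0 < n ->
  exists S : strategy n 2 (Mad n), transmits_single_error S.
Proof.
case: n => // N _; have vol := @Mad_volume N.+1 isT.
pose t := trunc_log 2 N.+1; pose k := 2 ^ t - 1; pose d := N - k.
have tN : 2 ^ t <= N.+1 < 2 ^ t.+1 by apply: trunc_log_bounds.
have [c1 [c2 [c3 dec]]] := exists_block_codes tN vol.
have sumN : 1 + d + k = N.+1 by rewrite /d /k; lia.
exact: three_block_strategy sumN dec.
Qed.
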